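(* The pair $(\to_{\mathtt f},\multimap_{\mathtt{uf}})$, formed by the Fireball Calculus reduction and the Useful Fireball Calculus reduction, is a locally bounded high-level implementation system, and so $\multimap_{\mathtt{uf}}$ has a quadratic overhead with respect to $\to_{\mathtt f}$, i.e. $|d|=O(|d{\downarrow}|^2)$ for every derivation $d:t\multimap_{\mathtt{uf}}^*u$ from a $\lambda$-term $t$ without explicit substitutions, where $d{\downarrow}:t\to_{\mathtt f}^*u{\downarrow}$ is its projection.
   Context: **Fireball Calculus (FBC).** Terms ($\lambda$-terms): $t,u ::= x\mid a\mid\lambda x.t\mid tu$, where $x$ ranges over variables and $a$ over a separate set of symbols (constants, never bound nor substituted). Terms are taken up to $\alpha$-equivalence; $t\{x\leftarrow u\}$ is capture-avoiding substitution. Values $v::=\lambda x.t$; fireballs $f::=v\mid A$; inerts $A::=a\mid Af$. Evaluation contexts $F::=\langle\cdot\rangle\mid tF\mid Ff$. The rule is $F\langle(\lambda x.t)f\rangle\to_{\mathtt f}F\langle t\{x\leftarrow f\}\rangle$. **Explicit substitutions (ES).** Terms with ES add the construct $t[x\leftarrow u]$, binding $x$ in $t$. Values are still the abstractions. Unfolding: $x{\downarrow}=x$, $a{\downarrow}=a$, $(tu){\downarrow}=t{\downarrow}\,u{\downarrow}$, $(\lambda x.t){\downarrow}=\lambda x.t{\downarrow}$, $t[x\leftarrow u]{\downarrow}=t{\downarrow}\{x\leftarrow u{\downarrow}\}$. Plugging in a context may capture variables. Substitution contexts $L::=\langle\cdot\rangle\mid L[x\leftarrow t]$. Shallow contexts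 $S::=\langle\cdot\rangle\mid St\mid tS\mid S[x\leftarrow t]$. Unfolding of $t$ relative to $S$: $t{\downarrow}_{\langle\cdot\rangle}=t{\downarrow}$, $t{\downarrow}_{uS}=t{\downarrow}_{Su}=t{\downarrow}_S$, $t{\downarrow}_{S[x\leftarrow u]}=t{\downarrow}_S\{x\leftarrow u{\downarrow}\}$. **Useful contexts.** Evaluable shallow contexts: $\langle\cdot\rangle$ is evaluable; $St$ is evaluable if $S$ is and $t{\downarrow}$ is a fireball; $tS$ is evaluable if $S$ is; $S[x\leftarrow t]$ is evaluable if $t{\downarrow}$ is a fireball and $S\{x\leftarrow t{\downarrow}\}$ is evaluable. $S$ is applicative if $S=S'\langle L\,u\rangle$ for some $S',L,u$ (the hole of $S$ being the hole of $L$); $S$ is useful if it is evaluable and applicative. **Useful FBC.** $\multimap_{\mathtt{uf}}=\multimap_{\mathtt{um}}\cup\multimap_{\mathtt{ue}}$ (up to $\alpha$; the displayed $x$ is bound by the displayed ES on $x$, and moving $L$ outwards captures no variable): - (multiplicative) $S\langle L\langle\lambda x.t\rangle u\rangle\multimap_{\mathtt{um}}S\langle L\langle t[x\leftarrow u]\rangle\rangle$ if $S\langle L\,u\rangle$ is useful; - (exponential) $S\langle S'\langle x\rangle[x\leftarrow L\langle u\rangle]\rangle\multimap_{\mathtt{ue}}S\langle L\langle S'\langle u\rangle[x\leftarrow u]\rangle\rangle$ if $S\langle S'[x\leftarrow L\langle u\rangle]\rangle$ is useful, $u$ is not of the form $u'[y\leftarrow w]$, and $u{\downarrow}_{S\langle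 L\rangle}$ is a value. **High-level implementation systems.** For a derivation $d$, $|d|$ is its length and $|d|_{\mathtt m}$, $|d|_{\mathtt e}$ its numbers of multiplicative and exponential steps. Given a deterministic strategy $\to_{\mathtt f}$ on FBC terms and a deterministic strategy $\multimap$ on terms with ES (made of multiplicative and exponential steps), $(\to_{\mathtt f},\multimap)$ is a high-level implementation system if whenever $t$ is a $\lambda$-term (no ES) and $d:t\multimap^*u$: (Normal form) if $u$ is $\multimap$-normal then $u{\downarrow}$ is $\to_{\mathtt f}$-normal; (Projection) there is a derivation $d{\downarrow}:t{\downarrow}\to_{\mathtt f}^*u{\downarrow}$ with $|d{\downarrow}|=|d|_{\mathtt m}$. It is locally bounded if, moreover, the length of any sequence of exponential steps from $u$ is linear in $|d|_{\mathtt m}$, i.e. at most $c\cdot|d|_{\mathtt m}$ for a constant $c$ independent of $t$ and $d$. *)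

(* Defs.v *)
From Stdlib Require Import Arith.

Set Implicit Arguments.

(* Terms are taken up to alpha-equivalence by using de Bruijn indices, with
   parallel substitutions [nat -> term].  Index [i] under [k <= i] binders is
   the free variable number [i - k].  [Sy] is the set of constants. *)

Definition scons {X : Type} (x : X) (s : nat -> X) (n : nat) : X :=
  match n with 0 => x | S m => s m end.

Definition up_ren (r : nat -> nat) : nat -> nat := scons 0 (fun n => S (r n)).

Inductive term (Sy : Type) : Type :=
| Var (n : nat)
| Cst (a : Sy)
| Lam (t : term Sy)
| App (t u : term Sy).

Arguments Var {Sy} n.

Fixpoint rename {Sy} (r : nat -> nat) (t : term Sy) : term Sy :=
  match t with
  | Var n => Var (r n)
  | Cst a => Cst a
  | Lam t => Lam (rename (up_ren r) t)
  | App t u => App (rename r t) (rename r u)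
  end.

Definition up {Sy} (s : nat -> term Sy) : nat -> term Sy :=
  scons (Var 0) (fun n => rename S (s n)).

Fixpoint subst {Sy} (s : nat -> term Sy) (t : term Sy) : term Sy :=
  match t with
  | Var n => s n
  | Cst a => Cst a
  | Lam t => Lam (subst (up s) t)
  | App t u => App (subst s t) (subst s u)
  end.

(* t{x<-u}, where x is the index 0 of t. *)
Definition subst1 {Sy} (t u : term Sy) : term Sy := subst (scons u Var) t.

Inductive value {Sy} : term Sy -> Prop :=
| value_lam t : value (Lam t).

Inductive fireball {Sy} : term Sy -> Prop :=
| fireball_value v : value v -> fireball v
| fireball_inert A : inert A -> fireball A
with inert {Sy} : term Sy -> Prop :=
| inert_cst a : inert (Cst a)
| inert_app A f : inert A -> fireball f -> inert (App A f).

Inductive fctx (Sy : Type) : Type :=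
| FHole
| FAppR (t : term Sy) (F : fctx Sy)
| FAppL (F : fctx Sy) (u : term Sy).

Arguments FHole {Sy}.

Inductive evaluation_ctx {Sy} : fctx Sy -> Prop :=
| evaluation_hole : evaluation_ctx FHole
| evaluation_appR t F : evaluation_ctx F -> evaluation_ctx (FAppR t F)
| evaluation_appL F f :
    evaluation_ctx F -> fireball f -> evaluation_ctx (FAppL F f).

Fixpoint fplug {Sy} (F : fctx Sy) (t : term Sy) : term Sy :=
  match F with
  | FHole => t
  | FAppR u F => App u (fplug F t)
  | FAppL F u => App (fplug F t) u
  end.

Inductive fstep {Sy} : term Sy -> term Sy -> Prop :=
| fstep_beta F t f :
    evaluation_ctx F -> fireball f ->
    fstep (fplug F (App (Lam t) f)) (fplug F (subst1 t f)).

(* [ES t u] is t[x<-u]; it binds the index 0 of [t]. *)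
Inductive eterm (Sy : Type) : Type :=
| EVar (n : nat)
| ECst (a : Sy)
| ELam (t : eterm Sy)
| EApp (t u : eterm Sy)
| ES (t u : eterm Sy).

Arguments EVar {Sy} n.

Fixpoint embed {Sy} (t : term Sy) : eterm Sy :=
  match t with
  | Var n => EVar n
  | Cst a => ECst a
  | Lam t => ELam (embed t)
  | App t u => EApp (embed t) (embed u)
  end.

Fixpoint unfold {Sy} (t : eterm Sy) : term Sy :=
  match t with
  | EVar n => Var n
  | ECst a => Cst a
  | ELam t => Lam (unfold t)
  | EApp t u => App (unfold t) (unfold u)
  | ES t u => subst1 (unfold t) (unfold u)
  end.

Fixpoint erename {Sy} (r : nat -> nat) (t : eterm Sy) : eterm Sy :=
  match t with
  | EVar n => EVar (r n)
  | ECst a => ECst a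
  | ELam t => ELam (erename (up_ren r) t)
  | EApp t u => EApp (erename r t) (erename r u)
  | ES t u => ES (erename (up_ren r) t) (erename r u)
  end.

Definition eup {Sy} (s : nat -> eterm Sy) : nat -> eterm Sy :=
  scons (EVar 0) (fun n => erename S (s n)).

Fixpoint esubst {Sy} (s : nat -> eterm Sy) (t : eterm Sy) : eterm Sy :=
  match t with
  | EVar n => s n
  | ECst a => ECst a
  | ELam t => ELam (esubst (eup s) t)
  | EApp t u => EApp (esubst s t) (esubst s u)
  | ES t u => ES (esubst (eup s) t) (esubst s u)
  end.

Inductive sctx (Sy : Type) : Type :=
| CHole
| CAppL (C : sctx Sy) (t : eterm Sy)
| CAppR (t : eterm Sy) (C : sctx Sy)
| CES (C : sctx Sy) (t : eterm Sy).

Arguments CHole {Sy}.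

Inductive substitution_ctx {Sy} : sctx Sy -> Prop :=
| substitution_hole : substitution_ctx CHole
| substitution_es L t : substitution_ctx L -> substitution_ctx (CES L t).

(* Plugging captures: the indices [0 .. depth C - 1] of [t] become bound by the
   explicit substitutions of [C] that enclose the hole. *)
Fixpoint plug {Sy} (C : sctx Sy) (t : eterm Sy) : eterm Sy :=
  match C with
  | CHole => t
  | CAppL C u => EApp (plug C t) u
  | CAppR u C => EApp u (plug C t)
  | CES C u => ES (plug C t) u
  end.

Fixpoint comp {Sy} (C D : sctx Sy) : sctx Sy :=
  match C with
  | CHole => D
  | CAppL C u => CAppL (comp C D) u
  | CAppR u C => CAppR u (comp C D)
  | CES C u => CES (comp C D) u
  end.

Fixpoint depth {Sy} (C : sctx Sy) : nat :=
  match C with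
  | CHole => 0
  | CAppL C _ => depth C
  | CAppR _ C => depth C
  | CES C _ => S (depth C)
  end.

Fixpoint crename {Sy} (r : nat -> nat) (C : sctx Sy) : sctx Sy :=
  match C with
  | CHole => CHole
  | CAppL C u => CAppL (crename r C) (erename r u)
  | CAppR u C => CAppR (erename r u) (crename r C)
  | CES C u => CES (crename (up_ren r) C) (erename r u)
  end.

Fixpoint csubst {Sy} (s : nat -> eterm Sy) (C : sctx Sy) : sctx Sy :=
  match C with
  | CHole => CHole
  | CAppL C u => CAppL (csubst s C) (esubst s u)
  | CAppR u C => CAppR (esubst s u) (csubst s C)
  | CES C u => CES (csubst (eup s) C) (esubst s u)
  end.

Definition csubst1 {Sy} (C : sctx Sy) (u : eterm Sy) : sctx Sy :=
  csubst (scons u EVar) C.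

Fixpoint unfold_in {Sy} (C : sctx Sy) (t : eterm Sy) : term Sy :=
  match C with
  | CHole => unfold t
  | CAppL C _ => unfold_in C t
  | CAppR _ C => unfold_in C t
  | CES C u => subst1 (unfold_in C t) (unfold u)
  end.

Inductive evaluable {Sy} : sctx Sy -> Prop :=
| evaluable_hole : evaluable CHole
| evaluable_appL C t :
    evaluable C -> fireball (unfold t) -> evaluable (CAppL C t)
| evaluable_appR t C : evaluable C -> evaluable (CAppR t C)
| evaluable_es C t :
    fireball (unfold t) -> evaluable (csubst1 C (embed (unfold t))) ->
    evaluable (CES C t).

Definition applicative {Sy} (C : sctx Sy) : Prop :=
  exists C' L u, substitution_ctx L /\ C = comp C' (CAppL L u).

Definition useful {Sy} (C : sctx Sy) : Prop := evaluable C /\ applicative C.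

Definition is_es {Sy} (t : eterm Sy) : Prop := exists t' w, t = ES t' w.

Inductive kind : Type := multiplicative | exponential.

(* The renamings account for the scopes entered by a subterm that is moved.
   Multiplicative rule: the argument [u] enters the scope of [L].
   Exponential rule: the variable x, which is the index 0 just inside its
   explicit substitution, is [EVar (depth D)] in the hole of [D].  [D] enters
   the scope of [L], which inserts [depth L] binders just outside x; and the
   copy of [u] that replaces x enters the scopes of x and of [D]. *)
Inductive ufstep {Sy} : kind -> eterm Sy -> eterm Sy -> Prop :=
| ufstep_m C L t u :
    substitution_ctx L ->
    useful (comp C (CAppL L u)) ->
    ufstep multiplicative
      (plug C (EApp (plug L (ELam t)) u))
      (plug C (plug L (ES t (erename (Nat.add (depth L)) u))))
| ufstep_e C D L u :
    substitution_ctx L ->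
    useful (comp C (CES D (plug L u))) ->
    ~ is_es u ->
    value (unfold_in (comp C L) u) ->
    ufstep exponential
      (plug C (ES (plug D (EVar (depth D))) (plug L u)))
      (plug C (plug L
        (ES (plug (crename (up_ren (Nat.add (depth L))) D)
                  (erename (Nat.add (S (depth D))) u))
            u))).

Inductive derivation {K A : Type} (R : K -> A -> A -> Prop) : A -> A -> Type :=
| dnil x : derivation R x x
| dcons k x y z : R k x y -> derivation R y z -> derivation R x z.

Arguments dnil {K A R} x.
Arguments dcons {K A R} k {x y z} r d.

Fixpoint len {K A} {R : K -> A -> A -> Prop} {x y} (d : derivation R x y) : nat :=
  match d with
  | dnil _ => 0
  | dcons _ _ d' => S (len d')
  end.

Fixpoint mlen {A} {R : kind -> A -> A -> Prop} {x y} (d : derivation R x y) : nat :=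
  match d with
  | dnil _ => 0
  | dcons multiplicative _ d' => S (mlen d')
  | dcons exponential _ d' => mlen d'
  end.

Definition unlabelled {A : Type} (R : A -> A -> Prop) : unit -> A -> A -> Prop :=
  fun _ => R.

Definition union {A : Type} (R : kind -> A -> A -> Prop) (x y : A) : Prop :=
  exists k, R k x y.

Definition deterministic {A : Type} (R : A -> A -> Prop) : Prop :=
  forall x y z, R x y -> R x z -> y = z.

Definition normal {A : Type} (R : A -> A -> Prop) (x : A) : Prop :=
  forall y, ~ R x y.

Record high_level_system {Sy} (Rf : term Sy -> term Sy -> Prop)
    (R : kind -> eterm Sy -> eterm Sy -> Prop) : Prop := {
  hl_deterministic_f : deterministic Rf;
  hl_deterministic : deterministic (union R);
  hl_normal_form : forall (t : term Sy) (u : eterm Sy),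
    derivation R (embed t) u -> normal (union R) u -> normal Rf (unfold u);
  hl_projection : forall (t : term Sy) (u : eterm Sy)
    (d : derivation R (embed t) u),
    exists d' : derivation (unlabelled Rf) (unfold (embed t)) (unfold u),
      len d' = mlen d
}.

Record locally_bounded_system {Sy} (Rf : term Sy -> term Sy -> Prop)
    (R : kind -> eterm Sy -> eterm Sy -> Prop) : Prop := {
  lb_high_level : high_level_system Rf R;
  lb_bound : exists c : nat, forall (t : term Sy) (u v : eterm Sy)
    (d : derivation R (embed t) u)
    (e : derivation (unlabelled (R exponential)) u v),
    len e <= c * mlen d
}.

(* The projection d' of a derivation d is only determined by its endpoints and
   by the equation |d'| = |d|_m. *)
Definition quadratic_overhead {Sy} (Rf : term Sy -> term Sy -> Prop)
    (R : kind -> eterm Sy -> eterm Sy -> Prop) : Prop :=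
  exists c : nat, forall (t : term Sy) (u : eterm Sy)
    (d : derivation R (embed t) u),
    exists d' : derivation (unlabelled Rf) t (unfold u),
      len d' = mlen d /\ len d <= c * len d' ^ 2.

(* Main.v *)
(** Every ingredient is read in an environment [sigma], which maps the indices
    in scope to the unfoldings of the enclosing explicit substitutions: a
    shallow context then unfolds to an applicative context [frame sigma C], and
    evaluability of [C] says that this is an evaluation context.

    A redex of either kind is a leaf (a variable or an abstraction) in a useful
    context, whose unfolding in the environment of that context is a value.
    Useful contexts unfold to evaluation contexts whose hole is applied to a
    fireball, so such a leaf unfolds to the unique beta-redex; this gives
    determinism, and the projection property by computing both sides.  The
    normal form property holds because in reachable terms every explicit
    substitution contains (the unfolding of) a fireball.

    Multiplicative steps create one explicit substitution each and exponential
    steps none.  After an exponential step the redex leaf stays where it is, and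
    the binder of the new leaf is strictly outside the binder of the old one,
    so that a sequence of exponential steps is no longer than the number of
    explicit substitutions. *)
From Stdlib Require Import Arith Lia FunctionalExtensionality.
Require Import Defs.

Set Implicit Arguments.

(** * Substitution *)

Lemma rename_rename {Sy} (t : term Sy) : forall r s,
  rename r (rename s t) = rename (fun n => r (s n)) t.
Proof.
  induction t as [n | a | t IH | t IHt u IHu]; intros r s; simpl; trivial.
  - f_equal. rewrite IH. f_equal. extensionality n. now destruct n.
  - now rewrite IHt, IHu.
Qed.

Lemma subst_rename {Sy} (t : term Sy) : forall s r,
  subst s (rename r t) = subst (fun n => s (r n)) t.
Proof.
  induction t as [n | a | t IH | t IHt u IHu]; intros s r; simpl; trivial.
  - f_equal. rewrite IH. f_equal. extensionality n. now destruct n.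
  - now rewrite IHt, IHu.
Qed.

Lemma rename_subst {Sy} (t : term Sy) : forall r s,
  rename r (subst s t) = subst (fun n => rename r (s n)) t.
Proof.
  induction t as [n | a | t IH | t IHt u IHu]; intros r s; simpl; trivial.
  - f_equal. rewrite IH. f_equal. extensionality n. destruct n; simpl; trivial.
    now rewrite !rename_rename.
  - now rewrite IHt, IHu.
Qed.

Lemma up_Var {Sy} : up Var = (Var : nat -> term Sy).
Proof. extensionality n. now destruct n. Qed.

Lemma subst_Var {Sy} (t : term Sy) : subst Var t = t.
Proof.
  induction t as [n | a | t IH | t IHt u IHu]; simpl; trivial.
  - now rewrite up_Var, IH.
  - now rewrite IHt, IHu.
Qed.

(** * Unfolding in an environment *)

(** An explicit substitution extends the environment instead of substituting in the result, so that
    unfolding can be followed under contexts; [unfold] is the case [sigma := Var]. *)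
Fixpoint unf {Sy} (sigma : nat -> term Sy) (t : eterm Sy) : term Sy :=
  match t with
  | EVar n => sigma n
  | ECst a => Cst a
  | ELam t => Lam (unf (up sigma) t)
  | EApp t u => App (unf sigma t) (unf sigma u)
  | ES t u => unf (scons (unf sigma u) sigma) t
  end.

Lemma unf_erename {Sy} (t : eterm Sy) : forall sigma r,
  unf sigma (erename r t) = unf (fun n => sigma (r n)) t.
Proof.
  induction t as [n | a | t IH | t IHt u IHu | t IHt u IHu];
    intros sigma r; simpl; trivial.
  - f_equal. rewrite IH. f_equal. extensionality n. now destruct n.
  - now rewrite IHt, IHu.
  - rewrite IHu, IHt. f_equal. extensionality n. now destruct n.
Qed.

Lemma rename_unf {Sy} (t : eterm Sy) : forall r sigma,
  rename r (unf sigma t) = unf (fun n => rename r (sigma n)) t.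
Proof.
  induction t as [n | a | t IH | t IHt u IHu | t IHt u IHu];
    intros r sigma; simpl; trivial.
  - f_equal. rewrite IH. f_equal. extensionality n. destruct n; simpl; trivial.
    now rewrite !rename_rename.
  - now rewrite IHt, IHu.
  - rewrite IHt, <- IHu. f_equal. extensionality n. now destruct n.
Qed.

Lemma unf_esubst {Sy} (t : eterm Sy) : forall sigma s,
  unf sigma (esubst s t) = unf (fun n => unf sigma (s n)) t.
Proof.
  induction t as [n | a | t IH | t IHt u IHu | t IHt u IHu];
    intros sigma s; simpl; trivial.
  - f_equal. rewrite IH. f_equal. extensionality n. destruct n; simpl; trivial.
    now rewrite unf_erename, rename_unf.
  - now rewrite IHt, IHu.
  - rewrite IHu, IHt. f_equal. extensionality n. destruct n; simpl; trivial.
    now rewrite unf_erename.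
Qed.

Lemma subst_unf {Sy} (t : eterm Sy) : forall tau sigma,
  subst tau (unf sigma t) = unf (fun n => subst tau (sigma n)) t.
Proof.
  induction t as [n | a | t IH | t IHt u IHu | t IHt u IHu];
    intros tau sigma; simpl; trivial.
  - f_equal. rewrite IH. f_equal. extensionality n. destruct n; simpl; trivial.
    now rewrite subst_rename, rename_subst.
  - now rewrite IHt, IHu.
  - rewrite IHt, <- IHu. f_equal. extensionality n. now destruct n.
Qed.

Lemma unf_embed {Sy} (t : term Sy) : forall sigma,
  unf sigma (embed t) = subst sigma t.
Proof.
  induction t as [n | a | t IH | t IHt u IHu]; intros sigma; simpl; trivial.
  - now rewrite IH.
  - now rewrite IHt, IHu.
Qed.

Lemma subst_subst {Sy} (t : term Sy) tau sigma :
  subst tau (subst sigma t) = subst (fun n => subst tau (sigma n)) t.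
Proof. now rewrite <- !(unf_embed t), subst_unf. Qed.

(** Contracting a beta-redex amounts to extending the environment with its argument; this is where a
    multiplicative step meets a beta-step. *)
Lemma subst1_unf_up {Sy} (t : eterm Sy) sigma v :
  subst1 (unf (up sigma) t) v = unf (scons v sigma) t.
Proof.
  unfold subst1. rewrite subst_unf. f_equal. extensionality n.
  destruct n; simpl; trivial. rewrite subst_rename. apply subst_Var.
Qed.

Lemma unfold_unf {Sy} (t : eterm Sy) : unfold t = unf Var t.
Proof.
  induction t as [n | a | t IH | t IHt u IHu | t IHt u IHu]; simpl; trivial.
  - now rewrite up_Var, IH.
  - now rewrite IHt, IHu.
  - now rewrite <- subst1_unf_up, up_Var, IHt, IHu.
Qed.

Lemma unfold_embed {Sy} (t : term Sy) : unfold (embed t) = t.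
Proof. now rewrite unfold_unf, unf_embed, subst_Var. Qed.

(** * Contexts in an environment *)

Fixpoint env {Sy} (sigma : nat -> term Sy) (C : sctx Sy) : nat -> term Sy :=
  match C with
  | CHole => sigma
  | CAppL C _ => env sigma C
  | CAppR _ C => env sigma C
  | CES C u => env (scons (unf sigma u) sigma) C
  end.

Fixpoint frame {Sy} (sigma : nat -> term Sy) (C : sctx Sy) : fctx Sy :=
  match C with
  | CHole => FHole
  | CAppL C u => FAppL (frame sigma C) (unf sigma u)
  | CAppR u C => FAppR (unf sigma u) (frame sigma C)
  | CES C u => frame (scons (unf sigma u) sigma) C
  end.

(** Unlike in [evaluable], nothing is substituted in the context, so the recursion is structural. *)
Fixpoint evaluable_env {Sy} (sigma : nat -> term Sy) (C : sctx Sy) : Prop :=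
  match C with
  | CHole => True
  | CAppL C u => evaluable_env sigma C /\ fireball (unf sigma u)
  | CAppR _ C => evaluable_env sigma C
  | CES C u =>
      fireball (unf sigma u) /\ evaluable_env (scons (unf sigma u) sigma) C
  end.

(* [applied C b]: the hole of [C] is applied, up to explicit substitutions, when
   [b] tells whether [C] itself is. *)
Fixpoint applied {Sy} (C : sctx Sy) (b : Prop) : Prop :=
  match C with
  | CHole => b
  | CAppL C _ => applied C True
  | CAppR _ C => applied C False
  | CES C _ => applied C b
  end.

Lemma unf_plug {Sy} (C : sctx Sy) t : forall sigma,
  unf sigma (plug C t) = fplug (frame sigma C) (unf (env sigma C) t).
Proof.
  induction C as [| C IH u | u C IH | C IH u]; intros sigma; simpl;
    now rewrite ?IH.
Qed.

Lemma plug_comp {Sy} (C D : sctx Sy) t : plug (comp C D) t = plug C (plug D t).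
Proof.
  induction C as [| C IH u | u C IH | C IH u]; simpl; now rewrite ?IH.
Qed.

Lemma depth_comp {Sy} (C D : sctx Sy) : depth (comp C D) = depth C + depth D.
Proof.
  induction C as [| C IH u | u C IH | C IH u]; simpl; now rewrite ?IH.
Qed.

Lemma env_comp {Sy} (C D : sctx Sy) : forall sigma,
  env sigma (comp C D) = env (env sigma C) D.
Proof.
  induction C as [| C IH u | u C IH | C IH u]; intros sigma; simpl; now rewrite ?IH.
Qed.

Lemma evaluable_env_comp {Sy} (C D : sctx Sy) : forall sigma,
  evaluable_env sigma (comp C D) <->
  evaluable_env sigma C /\ evaluable_env (env sigma C) D.
Proof.
  induction C as [| C IH u | u C IH | C IH u]; intros sigma; simpl;
    rewrite ?IH; tauto.
Qed.

Lemma applied_comp {Sy} (C D : sctx Sy) : forall b,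
  applied (comp C D) b = applied D (applied C b).
Proof.
  induction C as [| C IH u | u C IH | C IH u]; intros b; simpl; now rewrite ?IH.
Qed.

Lemma applied_mono {Sy} (C : sctx Sy) : forall b b' : Prop,
  applied C b -> (b -> b') -> applied C b'.
Proof.
  induction C as [| C IH u | u C IH | C IH u]; intros b b'; simpl; eauto.
Qed.

Lemma depth_crename {Sy} (C : sctx Sy) : forall r, depth (crename r C) = depth C.
Proof.
  induction C as [| C IH u | u C IH | C IH u]; intros r; simpl; now rewrite ?IH.
Qed.

Lemma frame_crename {Sy} (C : sctx Sy) : forall sigma r,
  frame sigma (crename r C) = frame (fun n => sigma (r n)) C.
Proof.
  induction C as [| C IH u | u C IH | C IH u]; intros sigma r; simpl;
    rewrite ?IH, ?unf_erename; trivial.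
  f_equal. extensionality n. now destruct n.
Qed.

Lemma evaluable_env_crename {Sy} (C : sctx Sy) : forall sigma r,
  evaluable_env sigma (crename r C) <-> evaluable_env (fun n => sigma (r n)) C.
Proof.
  induction C as [| C IH u | u C IH | C IH u]; intros sigma r; simpl;
    rewrite ?IH, ?unf_erename; try tauto.
  replace (fun n => scons _ sigma (up_ren r n))
    with (scons (unf (fun n => sigma (r n)) u) (fun n => sigma (r n))).
  - tauto.
  - extensionality n. now destruct n.
Qed.

Lemma applied_crename {Sy} (C : sctx Sy) : forall b r,
  applied (crename r C) b = applied C b.
Proof.
  induction C as [| C IH u | u C IH | C IH u]; intros b r; simpl; now rewrite ?IH.
Qed.

Lemma env_add_depth {Sy} (C : sctx Sy) : forall n sigma,
  env sigma C (depth C + n) = sigma n.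
Proof.
  induction C as [| C IH u | u C IH | C IH u]; intros n sigma; simpl; trivial.
  replace (S (depth C + n)) with (depth C + S n) by lia. now rewrite IH.
Qed.

Lemma env_depth {Sy} (C : sctx Sy) sigma : env sigma C (depth C) = sigma 0.
Proof. rewrite <- (env_add_depth C 0 sigma). f_equal. lia. Qed.

Lemma evaluation_frame {Sy} (C : sctx Sy) : forall sigma,
  evaluable_env sigma C -> evaluation_ctx (frame sigma C).
Proof.
  induction C as [| C IH u | u C IH | C IH u]; intros sigma; simpl; intros H.
  - constructor.
  - constructor; [apply IH |]; tauto.
  - constructor. now apply IH.
  - now apply IH.
Qed.

Lemma frame_substitution {Sy} (L : sctx Sy) :
  substitution_ctx L -> forall sigma, frame sigma L = FHole.
Proof. induction 1; intros sigma; simpl; auto. Qed.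

Lemma unf_plug_substitution {Sy} (L : sctx Sy) t sigma :
  substitution_ctx L -> unf sigma (plug L t) = unf (env sigma L) t.
Proof. intros HL. now rewrite unf_plug, frame_substitution. Qed.

Lemma applied_substitution {Sy} (L : sctx Sy) b :
  substitution_ctx L -> applied L b = b.
Proof. induction 1; simpl; auto. Qed.

Lemma applicative_applied {Sy} (C : sctx Sy) :
  applicative C <-> applied C False.
Proof.
  (* With [b] arbitrary the induction passes through applications: either only explicit
     substitutions lead to the hole and [b] is inherited, or the application sought lies inside
     [C]. *)
  assert (split : forall b, applied C b ->
    (substitution_ctx C /\ b) \/ applicative C).
  { induction C as [| C IH u | u C IH | C IH u]; intros b; simpl; intros H.
    - left. split; trivial. constructor.
    - right. destruct (IH _ H) as [[HC _] | (C' & L & w & HL & ->)].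
      + now exists CHole, C, u.
      + now exists (CAppL C' u), L, w.
    - right. destruct (IH _ H) as [[_ []] | (C' & L & w & HL & ->)].
      now exists (CAppR u C'), L, w.
    - destruct (IH _ H) as [[HC Hb] | (C' & L & w & HL & ->)].
      + left. split; trivial. now constructor.
      + right. now exists (CES C' u), L, w. }
  split.
  - intros (C' & L & u & HL & ->). rewrite applied_comp. simpl.
    now rewrite applied_substitution.
  - intros H. destruct (split _ H) as [[_ []] | H']; trivial.
Qed.

Lemma evaluable_env_csubst {Sy} (C : sctx Sy) : forall sigma s,
  evaluable_env sigma (csubst s C) <->
  evaluable_env (fun n => unf sigma (s n)) C.
Proof.
  induction C as [| C IH u | u C IH | C IH u]; intros sigma s; simpl;
    rewrite ?IH, ?unf_esubst; try tauto.
  replace (fun n => unf (scons _ sigma) (eup s n))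
    with (scons (unf (fun n => unf sigma (s n)) u) (fun n => unf sigma (s n))).
  - tauto.
  - extensionality n. destruct n; simpl; trivial. now rewrite unf_erename.
Qed.

Fixpoint ctx_size {Sy} (C : sctx Sy) : nat :=
  match C with
  | CHole => 0
  | CAppL C _ => S (ctx_size C)
  | CAppR _ C => S (ctx_size C)
  | CES C _ => S (ctx_size C)
  end.

Lemma ctx_size_csubst {Sy} (C : sctx Sy) : forall s, ctx_size (csubst s C) = ctx_size C.
Proof.
  induction C as [| C IH u | u C IH | C IH u]; intros s; simpl; now rewrite ?IH.
Qed.

(** The induction is on size, since [evaluable] passes from [CES C t] to a substituted copy of [C],
    which has the size of [C] but is not a subterm. *)
Lemma evaluable_iff_env {Sy} (C : sctx Sy) : evaluable C <-> evaluable_env Var C.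
Proof.
  remember (ctx_size C) as n eqn:E. revert C E.
  induction n as [| n IH]; intros [| C u | u C | C u] E; simpl in *; try discriminate.
  - split; [trivial | constructor].
  - split.
    + intros H. inversion H; subst. rewrite <- IH, <- unfold_unf by lia. auto.
    + intros [HC Hu]. constructor; [apply IH; auto; lia | now rewrite unfold_unf].
  - split.
    + intros H. inversion H; subst. apply IH; trivial; lia.
    + intros H. constructor. apply IH; trivial; lia.
  - assert (Hs : evaluable (csubst1 C (embed (unfold u))) <->
                 evaluable_env (scons (unf Var u) Var) C).
    { unfold csubst1. rewrite IH by (rewrite ctx_size_csubst; lia).
      rewrite evaluable_env_csubst.
      replace (fun n => unf Var (scons _ EVar n)) with (scons (unf Var u) Var).
      - tauto.
      - extensionality k. destruct k; simpl; trivial.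
        now rewrite unf_embed, subst_Var, unfold_unf. }
    split.
    + intros H. inversion H; subst. rewrite <- Hs, <- unfold_unf. auto.
    + intros [Hu HC]. constructor; [now rewrite unfold_unf | now apply Hs].
Qed.

Lemma useful_iff_env {Sy} (C : sctx Sy) :
  useful C <-> evaluable_env Var C /\ applied C False.
Proof. unfold useful. now rewrite evaluable_iff_env, applicative_applied. Qed.

Lemma unfold_in_unf {Sy} (C : sctx Sy) t : unfold_in C t = unf (env Var C) t.
Proof.
  (* The environment is generalised because relative unfolding performs the outermost substitution
     last. *)
  assert (H : forall sigma, subst sigma (unfold_in C t) = unf (env sigma C) t).
  { induction C as [| C IH u | u C IH | C IH u]; intros sigma; simpl; trivial.
    - rewrite unfold_unf, subst_unf. trivial.
    - unfold subst1. rewrite subst_subst, <- IH. f_equal. extensionality n.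
      destruct n; simpl; trivial. now rewrite unfold_unf, subst_unf. }
  now rewrite <- H, subst_Var.
Qed.

(** * The Fireball Calculus *)

Lemma fstep_App_inv {Sy} (a b w : term Sy) :
  fstep (App a b) w ->
  (exists t, a = Lam t /\ fireball b /\ w = subst1 t b) \/
  (exists b', fstep b b' /\ w = App a b') \/
  (fireball b /\ exists a', fstep a a' /\ w = App a' b).
Proof.
  intros H. inversion H as [F t f HF Hf E E']. destruct HF as [| u F HF | F u HF Hu];
    simpl in *; injection E as <- <-.
  - left. eauto.
  - right; left. eexists. split; [now constructor | trivial].
  - right; right. split; trivial. eexists. split; [now constructor | trivial].
Qed.

Lemma fstep_is_App {Sy} (t w : term Sy) :
  fstep t w -> exists a b, t = App a b.
Proof. intros [F u f HF _]. destruct HF; simpl; eauto. Qed.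

Lemma inert_not_value {Sy} (t : term Sy) : inert t -> ~ value t.
Proof. intros H H'. destruct H'. inversion H. Qed.

(** An application that is a fireball is inert: its head is inert, hence no abstraction, and both
    components are fireballs. *)
Lemma fireball_normal {Sy} (t : term Sy) : fireball t -> normal fstep t.
Proof.
  induction t as [n | a | t IH | t IHt u IHu]; intros Ht w Hw;
    destruct (fstep_is_App Hw) as (t' & u' & E); try discriminate.
  injection E as <- <-.
  assert (Hin : inert t /\ fireball u).
  { inversion Ht as [v Hv | A HA]; subst; [inversion Hv | inversion HA; auto]. }
  destruct Hin as [HA Hf].
  destruct (fstep_App_inv Hw) as [(v & -> & _) | [(b & Hb & _) | (_ & b & Hb & _)]].
  - apply (inert_not_value HA). constructor.
  - exact (IHu Hf _ Hb).
  - apply (IHt (fireball_inert HA) _ Hb).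
Qed.

Lemma fstep_deterministic {Sy} : deterministic (@fstep Sy).
Proof.
  intros x.
  induction x as [n | a | t IH | t IHt u IHu]; intros y z Hy Hz;
    try solve [destruct (fstep_is_App Hy) as (t' & u' & E); discriminate].
  assert (lam : forall v w, fstep (Lam v : term Sy) w -> False).
  { intros v w H. apply (fireball_normal (fireball_value (value_lam v)) H). }
  destruct (fstep_App_inv Hy) as [(v & -> & Hf & ->) | [(b & Hb & ->) | (Hf & b & Hb & ->)]];
  destruct (fstep_App_inv Hz) as [(v' & E & Hf' & ->) | [(b' & Hb' & ->) | (Hf' & b' & Hb' & ->)]];
    subst; try solve [exfalso; eauto | exfalso; eapply fireball_normal; eauto].
  - now injection E as ->.
  - f_equal. eauto.
  - f_equal. eauto.
Qed.

(** * Determinism *)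

Definition leaf {Sy} (r : eterm Sy) : Prop :=
  match r with EVar _ | ELam _ => True | _ => False end.

(** Common form of both kinds of redex: the leaf is a variable for an exponential step and an
    abstraction for a multiplicative one. *)
Definition redex_at {Sy} (C : sctx Sy) (r : eterm Sy) : Prop :=
  useful C /\ leaf r /\ value (unf (env Var C) r).

Lemma value_leaf {Sy} (sigma : nat -> term Sy) u :
  ~ is_es u -> value (unf sigma u) -> leaf u.
Proof.
  intros Hu H. destruct u; simpl in *; trivial; try solve [inversion H].
  apply Hu. now eexists _, _.
Qed.

Lemma applicative_reducible {Sy} (C : sctx Sy) r sigma :
  evaluable_env sigma C -> applied C False -> value (unf (env sigma C) r) ->
  exists w, fstep (unf sigma (plug C r)) w.
Proof.
  intros HC Ha Hv. apply applicative_applied in Ha as (C' & L & u & HL & ->).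
  rewrite evaluable_env_comp in HC. destruct HC as [HC' [_ Hu]].
  rewrite env_comp in Hv. simpl in Hv.
  rewrite plug_comp, unf_plug. simpl. rewrite unf_plug_substitution by trivial.
  destruct Hv as [t]. eexists. constructor; trivial. now apply evaluation_frame.
Qed.

(** Two such contexts could part ways only at an application. One then requires the argument to be a
    fireball, hence normal, while the other puts a beta-redex in it. Since [r] and [r'] are leaves,
    neither hole lies properly inside the other. *)
Lemma plug_unique {Sy} (C : sctx Sy) : forall C' b sigma r r',
  leaf r -> leaf r' ->
  evaluable_env sigma C -> evaluable_env sigma C' ->
  applied C b -> applied C' b ->
  value (unf (env sigma C) r) -> value (unf (env sigma C') r') ->
  plug C r = plug C' r' -> C = C' /\ r = r'.
Proof.
  induction C as [| C IH u | u C IH | C IH u];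
    intros [| C' u' | u' C' | C' u'] b sigma r r' Hr Hr' HC HC' Ha Ha' Hv Hv' E;
    simpl in *;
    try solve [subst; contradiction | subst; simpl in *; contradiction | discriminate];
    auto.
  - injection E as E ->.
    destruct (IH _ _ _ _ _ Hr Hr' (proj1 HC) (proj1 HC') Ha Ha' Hv Hv' E); subst; auto.
  - injection E as E ->.
    destruct (applicative_reducible _ _ _ HC' Ha' Hv') as [w Hw].
    destruct (fireball_normal (proj2 HC) Hw).
  - injection E as -> E. rewrite <- E in *.
    destruct (applicative_reducible _ _ _ HC Ha Hv) as [w Hw].
    destruct (fireball_normal (proj2 HC') Hw).
  - injection E as -> E.
    destruct (IH _ _ _ _ _ Hr Hr' HC HC' Ha Ha' Hv Hv' E); subst; auto.
  - injection E as E ->.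
    destruct (IH _ _ _ _ _ Hr Hr' (proj2 HC) (proj2 HC') Ha Ha' Hv Hv' E); subst; auto.
Qed.

Lemma redex_at_unique {Sy} (C C' : sctx Sy) r r' :
  redex_at C r -> redex_at C' r' -> plug C r = plug C' r' -> C = C' /\ r = r'.
Proof.
  intros ([HC Ha]%useful_iff_env & Hr & Hv) ([HC' Ha']%useful_iff_env & Hr' & Hv').
  eapply plug_unique; eauto.
Qed.

Lemma value_env_CES {Sy} (C D L : sctx Sy) u :
  substitution_ctx L ->
  env Var (comp C (CES D (plug L u))) (depth D) = unf (env Var (comp C L)) u.
Proof.
  intros HL. rewrite !env_comp. simpl. rewrite env_depth. simpl.
  now apply unf_plug_substitution.
Qed.

Lemma redex_at_m {Sy} (C L : sctx Sy) t u :
  useful (comp C (CAppL L u)) -> redex_at (comp C (CAppL L u)) (ELam t).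
Proof. intros H. repeat split; trivial; apply H. Qed.

Lemma redex_at_e {Sy} (C D L : sctx Sy) u :
  substitution_ctx L -> useful (comp C (CES D (plug L u))) ->
  value (unfold_in (comp C L) u) ->
  redex_at (comp C (CES D (plug L u))) (EVar (depth D)).
Proof.
  intros HL H Hv. split; trivial. split; simpl; trivial.
  rewrite value_env_CES by trivial. now rewrite <- unfold_in_unf.
Qed.

(** A substitution context contains no application, so the innermost application on the path to the
    hole marks where [L] begins. *)
Lemma comp_CAppL_inj {Sy} (L L' : sctx Sy) u u' :
  substitution_ctx L -> substitution_ctx L' -> forall C C',
  comp C (CAppL L u) = comp C' (CAppL L' u') -> C = C' /\ L = L' /\ u = u'.
Proof.
  intros HL HL'.
  assert (no : forall M, substitution_ctx M ->
    forall (C : sctx Sy) w v, M <> comp C (CAppL w v)).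
  { induction 1 as [| M s HM IH]; intros C w v; destruct C; simpl; try discriminate.
    intros E. injection E as E _. now apply IH in E. }
  induction C as [| C IH v | v C IH | C IH v]; intros [| C' v' | v' C' | C' v'] E;
    simpl in E; try discriminate; injection E; intros; subst;
    try solve [auto | match goal with
      H : substitution_ctx (comp _ _) |- _ => destruct (no _ H _ _ _ eq_refl) end];
    match goal with H : comp _ _ = comp _ _ |- _ => apply IH in H end;
    intuition; subst; trivial.
Qed.

(** The number of binders between it and the hole singles out one explicit substitution on the
    path. *)
Lemma comp_CES_inj {Sy} (D D' : sctx Sy) w w' :
  depth D = depth D' -> forall C C',
  comp C (CES D w) = comp C' (CES D' w') -> C = C' /\ D = D' /\ w = w'.
Proof.
  intros HD.
  induction C as [| C IH v | v C IH | C IH v]; intros [| C' v' | v' C' | C' v'] E;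
    simpl in E; try discriminate; injection E; intros; subst;
    try solve [auto | rewrite depth_comp in HD; simpl in HD; lia];
    match goal with H : comp _ _ = comp _ _ |- _ => apply IH in H end;
    intuition; subst; trivial.
Qed.

Lemma plug_substitution_inj {Sy} (L L' : sctx Sy) u u' :
  substitution_ctx L -> substitution_ctx L' -> ~ is_es u -> ~ is_es u' ->
  plug L u = plug L' u' -> L = L' /\ u = u'.
Proof.
  intros HL. revert L'. induction HL as [| L t HL IH]; intros L' HL' Hu Hu' E;
    destruct HL' as [| L' t' HL']; simpl in E; auto.
  - exfalso. apply Hu. subst. now eexists _, _.
  - exfalso. apply Hu'. subst. now eexists _, _.
  - injection E as E ->. destruct (IH _ HL' Hu Hu' E); subst; auto.
Qed.

(** The redex leaf and its context are unique. The leaf fixes the kind of the step and, if a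
    variable, the depth of its binder; the context then splits in only one way. *)
Lemma ufstep_deterministic {Sy} : deterministic (union (@ufstep Sy)).
Proof.
  intros x y z [k H] [k' H'].
  destruct H as [C L t u HL HC | C D L u HL HC Hu Hv];
    inversion H' as [C' L' t' u' HL' HC' Ek E Ey | C' D' L' u' HL' HC' Hu' Hv' Ek E Ey];
    subst.
  - pose proof (redex_at_m _ _ t _ HC) as R. pose proof (redex_at_m _ _ t' _ HC') as R'.
    destruct (redex_at_unique R R') as [EC Er].
    { now rewrite !plug_comp. }
    apply comp_CAppL_inj in EC as (-> & -> & ->); trivial. now injection Er as ->.
  - pose proof (redex_at_m _ _ t _ HC) as R. pose proof (redex_at_e _ _ _ HL' HC' Hv') as R'.
    destruct (redex_at_unique R R') as [EC Er].
    { now rewrite !plug_comp. }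
    discriminate.
  - pose proof (redex_at_m _ _ t' _ HC') as R'. pose proof (redex_at_e _ _ _ HL HC Hv) as R.
    destruct (redex_at_unique R R') as [EC Er].
    { now rewrite !plug_comp. }
    discriminate.
  - pose proof (redex_at_e _ _ _ HL HC Hv) as R. pose proof (redex_at_e _ _ _ HL' HC' Hv') as R'.
    destruct (redex_at_unique R R') as [EC Er].
    { now rewrite !plug_comp. }
    injection Er as Ed. apply comp_CES_inj in EC as (-> & -> & Ew); trivial.
    apply plug_substitution_inj in Ew as [-> ->]; trivial.
Qed.

(** * Projection *)

Lemma env_weaken {Sy} (C : sctx Sy) sigma u :
  unf (env sigma C) (erename (Nat.add (depth C)) u) = unf sigma u.
Proof.
  rewrite unf_erename. f_equal. extensionality n. apply env_add_depth.
Qed.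

Lemma ufstep_m_unfold {Sy} (x y : eterm Sy) :
  ufstep multiplicative x y -> fstep (unfold x) (unfold y).
Proof.
  intros H. inversion H as [C L t u HL HC Ek Ex Ey |]; subst.
  apply useful_iff_env in HC as [HC _].
  apply evaluable_env_comp in HC as [HC [_ Hu]].
  rewrite !unfold_unf, !(unf_plug C). simpl. rewrite !unf_plug_substitution by trivial.
  simpl. rewrite env_weaken, <- subst1_unf_up.
  constructor; trivial. now apply evaluation_frame.
Qed.

(** The renaming skips the [depth L] binders inserted just outside index 0, so [D] reads the same
    environment after entering the scope of [L]. *)
Lemma scons_up_ren_env {Sy} (L : sctx Sy) sigma v :
  (fun n => scons v (env sigma L) (up_ren (Nat.add (depth L)) n)) = scons v sigma.
Proof. extensionality n. destruct n; simpl; trivial. apply env_add_depth. Qed.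

Lemma unf_copy {Sy} (C : sctx Sy) sigma r v u :
  unf (env (scons v sigma) (crename r C)) (erename (Nat.add (S (depth C))) u) =
  unf sigma u.
Proof.
  rewrite unf_erename. f_equal. extensionality n.
  replace (S (depth C) + n) with (depth (crename r C) + S n)
    by (rewrite depth_crename; lia).
  now rewrite env_add_depth.
Qed.

(** The variable and the copy that replaces it both unfold to the unfolding of [u] in the
    environment of [L], and the surrounding frames are unchanged. *)
Lemma ufstep_e_unfold {Sy} (x y : eterm Sy) :
  ufstep exponential x y -> unfold x = unfold y.
Proof.
  intros H. inversion H as [| C D L u HL HC Hu Hv Ek Ex Ey]; subst.
  rewrite !unfold_unf, !(unf_plug C). f_equal. cbn [unf].
  rewrite !(unf_plug_substitution _ _ HL). cbn [unf].
  rewrite !unf_plug, unf_copy, frame_crename, scons_up_ren_env. simpl.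
  now rewrite env_depth.
Qed.

Lemma projection {Sy} (x y : eterm Sy) (d : derivation ufstep x y) :
  exists d' : derivation (unlabelled fstep) (unfold x) (unfold y), len d' = mlen d.
Proof.
  induction d as [x | k x y z H d [d' IH]].
  - now exists (dnil _).
  - destruct k.
    + exists (dcons tt (ufstep_m_unfold H : unlabelled fstep tt _ _) d').
      simpl. now rewrite IH.
    + rewrite (ufstep_e_unfold H). now exists d'.
Qed.

(** * Reachable terms *)

Fixpoint pure {Sy} (t : eterm Sy) : Prop :=
  match t with
  | EVar _ | ECst _ => True
  | ELam t => pure t
  | EApp t u => pure t /\ pure u
  | ES _ _ => False
  end.

(** Invariant of reachable terms. Bodies of abstractions stay pure because reduction never enters
    them; fireball contents keep the environments normal. *)
Fixpoint proper {Sy} (sigma : nat -> term Sy) (t : eterm Sy) : Prop :=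
  match t with
  | EVar _ | ECst _ => True
  | ELam t => pure t
  | EApp t u => proper sigma t /\ proper sigma u
  | ES t u =>
      proper sigma u /\ fireball (unf sigma u) /\
      proper (scons (unf sigma u) sigma) t
  end.

Fixpoint proper_ctx {Sy} (sigma : nat -> term Sy) (C : sctx Sy) : Prop :=
  match C with
  | CHole => True
  | CAppL C u => proper_ctx sigma C /\ proper sigma u
  | CAppR u C => proper sigma u /\ proper_ctx sigma C
  | CES C u =>
      proper sigma u /\ fireball (unf sigma u) /\
      proper_ctx (scons (unf sigma u) sigma) C
  end.

Lemma proper_plug {Sy} (C : sctx Sy) t : forall sigma,
  proper sigma (plug C t) <-> proper_ctx sigma C /\ proper (env sigma C) t.
Proof.
  induction C as [| C IH u | u C IH | C IH u]; intros sigma; simpl;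
    rewrite ?IH; tauto.
Qed.

Lemma pure_erename {Sy} (t : eterm Sy) : forall r, pure (erename r t) <-> pure t.
Proof.
  induction t as [n | a | t IH | t IHt u IHu | t IHt u IHu]; intros r; simpl;
    rewrite ?IH, ?IHt, ?IHu; tauto.
Qed.

Lemma pure_proper {Sy} (t : eterm Sy) : forall sigma, pure t -> proper sigma t.
Proof.
  induction t as [n | a | t IH | t IHt u IHu | t IHt u IHu]; intros sigma; simpl;
    intuition.
Qed.

Lemma pure_embed {Sy} (t : term Sy) : pure (embed t).
Proof. induction t; simpl; auto. Qed.

Lemma proper_erename {Sy} (t : eterm Sy) : forall sigma r,
  proper sigma (erename r t) <-> proper (fun n => sigma (r n)) t.
Proof.
  induction t as [n | a | t IH | t IHt u IHu | t IHt u IHu]; intros sigma r; simpl;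
    rewrite ?pure_erename, ?IHt, ?IHu, ?unf_erename; try tauto.
  replace (fun n => scons _ sigma (up_ren r n))
    with (scons (unf (fun n => sigma (r n)) u) (fun n => sigma (r n))).
  - tauto.
  - extensionality n. now destruct n.
Qed.

Lemma proper_ctx_crename {Sy} (C : sctx Sy) : forall sigma r,
  proper_ctx sigma (crename r C) <-> proper_ctx (fun n => sigma (r n)) C.
Proof.
  induction C as [| C IH u | u C IH | C IH u]; intros sigma r; simpl;
    rewrite ?IH, ?proper_erename, ?unf_erename; try tauto.
  replace (fun n => scons _ sigma (up_ren r n))
    with (scons (unf (fun n => sigma (r n)) u) (fun n => sigma (r n))).
  - tauto.
  - extensionality n. now destruct n.
Qed.

Lemma proper_ctx_substitution {Sy} (L : sctx Sy) : substitution_ctx L ->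
  forall sigma, proper_ctx sigma L -> evaluable_env sigma L.
Proof. induction 1; intros sigma; simpl; intuition. Qed.

Lemma proper_weaken {Sy} (C : sctx Sy) sigma u :
  proper (env sigma C) (erename (Nat.add (depth C)) u) <-> proper sigma u.
Proof.
  rewrite proper_erename.
  replace (fun n => env sigma C (depth C + n)) with sigma; [tauto |].
  extensionality n. now rewrite env_add_depth.
Qed.

Lemma proper_copy {Sy} (C : sctx Sy) sigma r v u :
  proper (env (scons v sigma) (crename r C)) (erename (Nat.add (S (depth C))) u) <->
  proper sigma u.
Proof.
  rewrite proper_erename.
  replace (fun n => env _ _ (S (depth C) + n)) with sigma; [tauto |].
  extensionality n.
  replace (S (depth C) + n) with (depth (crename r C) + S n)
    by (rewrite depth_crename; lia).
  now rewrite env_add_depth.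
Qed.

(** The content of a new explicit substitution is an argument that evaluability makes a fireball,
    and its scope was the body of an abstraction, hence pure. An exponential step rearranges and
    copies proper pieces whose environments agree. *)
Lemma ufstep_proper {Sy} k (x y : eterm Sy) :
  ufstep k x y -> proper Var x -> proper Var y.
Proof.
  intros [C L t u HL HC | C D L u HL HC Hu Hv] H;
    apply useful_iff_env in HC as [HC _].
  - apply evaluable_env_comp in HC as [_ [_ Hf]].
    rewrite proper_plug in H. simpl in H. rewrite proper_plug in H. simpl in H.
    rewrite !proper_plug. simpl. rewrite proper_weaken, env_weaken.
    intuition. now apply pure_proper.
  - rewrite unfold_in_unf, env_comp in Hv.
    rewrite proper_plug in H. simpl in H. rewrite !proper_plug in H.
    rewrite !proper_plug. cbn [proper]. rewrite proper_plug, proper_copy, proper_ctx_crename.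
    rewrite scons_up_ren_env, <- (unf_plug_substitution _ _ HL).
    rewrite <- (unf_plug_substitution _ _ HL) in Hv.
    intuition.
Qed.

(** * Normal forms *)

(** Applications and constants never unfold to values, so only explicit substitutions surround the
    leaf; properness supplies the fireballs for evaluability. *)
Lemma value_spine {Sy} (a : eterm Sy) : forall sigma,
  proper sigma a -> value (unf sigma a) ->
  exists L r, substitution_ctx L /\ evaluable_env sigma L /\ leaf r /\
    a = plug L r /\ value (unf (env sigma L) r).
Proof.
  induction a as [n | c | t IH | t IHt u IHu | t IHt u IHu]; intros sigma Hp Hv;
    simpl in *; try solve [inversion Hv].
  - exists CHole, (EVar n). repeat split; trivial. constructor.
  - exists CHole, (ELam t). repeat split; trivial. constructor.
  - destruct Hp as (_ & Hf & Ht).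
    destruct (IHt _ Ht Hv) as (L & r & HL & He & Hr & -> & Hv').
    exists (CES L u), r. repeat split; trivial. now constructor.
Qed.

(** Converse of [applicative_reducible] for proper terms. As the environment is normal, no
    beta-redex comes from unfolding a variable: it stems from an application of [t] whose head is a
    leaf under explicit substitutions. *)
Lemma reducible_redex {Sy} (t : eterm Sy) : forall sigma w,
  (forall n, normal fstep (sigma n)) -> proper sigma t -> fstep (unf sigma t) w ->
  exists C r, evaluable_env sigma C /\ applied C False /\ leaf r /\
    t = plug C r /\ value (unf (env sigma C) r).
Proof.
  induction t as [n | c | t IH | a IHa b IHb | a IHa b IHb]; intros sigma w Hs Hp Hw;
    simpl in *.
  - destruct (Hs _ _ Hw).
  - destruct (fstep_is_App Hw) as (? & ? & E). discriminate.
  - destruct (fstep_is_App Hw) as (? & ? & E). discriminate.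
  - destruct (fstep_App_inv Hw) as [(v & Ea & Hf & _) | [(b' & Hb & _) | (Hf & a' & Ha & _)]].
    + destruct (value_spine _ sigma (proj1 Hp)) as (L & r & HL & He & Hr & -> & Hv).
      { rewrite Ea. constructor. }
      exists (CAppL L b), r. simpl. rewrite applied_substitution by trivial. auto 6.
    + destruct (IHb _ _ Hs (proj2 Hp) Hb) as (C & r & HC & HA & Hr & -> & Hv).
      exists (CAppR a C), r. auto 6.
    + destruct (IHa _ _ Hs (proj1 Hp) Ha) as (C & r & HC & HA & Hr & -> & Hv).
      exists (CAppL C b), r. simpl. pose proof (applied_mono (b' := True) C HA). auto 7.
  - destruct Hp as (_ & Hf & Ha).
    destruct (IHa (scons (unf sigma b) sigma) w) as (C & r & HC & HA & Hr & -> & Hv);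
      trivial.
    (* Properness makes the new entry a fireball, which keeps the environment normal. *)
    { intros [| n]; simpl; auto. now apply fireball_normal. }
    exists (CES C b), r. simpl. auto 6.
Qed.

Lemma env_bound {Sy} (C : sctx Sy) n : forall sigma,
  (exists D C' w, C = comp C' (CES D w) /\ n = depth D) \/
  (exists m, n = depth C + m /\ env sigma C n = sigma m).
Proof.
  induction C as [| C IH u | u C IH | C IH u]; intros sigma; simpl.
  - right. eauto.
  - destruct (IH sigma) as [(D & C' & w & -> & ->) | H]; auto.
    left. now exists D, (CAppL C' u), w.
  - destruct (IH sigma) as [(D & C' & w & -> & ->) | H]; auto.
    left. now exists D, (CAppR u C'), w.
  - destruct (IH (scons (unf sigma u) sigma))
      as [(D & C' & w & -> & ->) | ([| m] & -> & E)].
    + left. now exists D, (CES C' u), w.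
    + left. exists C, CHole, u. split; trivial. lia.
    + right. exists m. split; [lia | exact E].
Qed.

Lemma strip_substitutions {Sy} (w : eterm Sy) :
  exists L u, substitution_ctx L /\ ~ is_es u /\ w = plug L u.
Proof.
  induction w as [n | c | t IH | t IHt u IHu | t IHt u IHu];
    try match goal with |- exists L v, _ /\ _ /\ ?w = _ =>
      exists CHole, w; split; [constructor |]; split; trivial;
      now intros (? & ? & E) end.
  destruct IHt as (L & r & HL & Hr & ->). exists (CES L u), r.
  repeat split; trivial. now constructor.
Qed.

Lemma redex_at_step {Sy} (C : sctx Sy) r :
  redex_at C r -> exists k y, ufstep k (plug C r) y.
Proof.
  intros (HC & Hr & Hv). destruct r as [n | | t | |]; try contradiction.
  - destruct (env_bound C n Var) as [(D & C' & w & -> & ->) | (m & -> & E)].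
    + destruct (strip_substitutions w) as (L & u & HL & Hu & ->).
      simpl in Hv. rewrite value_env_CES, <- unfold_in_unf in Hv by trivial.
      exists exponential. eexists. rewrite plug_comp. now constructor.
    (* A variable free in the whole term unfolds to a variable, which is no value. *)
    + simpl in Hv. rewrite E in Hv. inversion Hv.
  - destruct (proj2 HC) as (C' & L & u & HL & ->).
    exists multiplicative. eexists. rewrite plug_comp. now constructor.
Qed.

Lemma normal_unfold {Sy} (u : eterm Sy) :
  proper Var u -> normal (union ufstep) u -> normal fstep (unfold u).
Proof.
  intros Hp Hn w Hw. rewrite unfold_unf in Hw.
  destruct (@reducible_redex Sy u Var w) as (C & r & HC & Ha & Hr & -> & Hv);
    trivial.
  { intros n y H. destruct (fstep_is_App H) as (? & ? & E). discriminate. }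
  destruct (@redex_at_step _ C r) as (k & y & Hy).
  { split; auto. now apply useful_iff_env. }
  apply (Hn y). now exists k.
Qed.

(** * Counting steps *)

Fixpoint es_count {Sy} (t : eterm Sy) : nat :=
  match t with
  | EVar _ | ECst _ | ELam _ => 0
  | EApp t u => es_count t + es_count u
  | ES t u => S (es_count t + es_count u)
  end.

Fixpoint es_count_ctx {Sy} (C : sctx Sy) : nat :=
  match C with
  | CHole => 0
  | CAppL C u => es_count_ctx C + es_count u
  | CAppR u C => es_count_ctx C + es_count u
  | CES C u => S (es_count_ctx C + es_count u)
  end.

Lemma es_count_plug {Sy} (C : sctx Sy) t :
  es_count (plug C t) = es_count_ctx C + es_count t.
Proof. induction C; simpl; lia. Qed.

Lemma es_count_erename {Sy} (t : eterm Sy) : forall r,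
  es_count (erename r t) = es_count t.
Proof. induction t; intros r; simpl; auto. Qed.

Lemma es_count_crename {Sy} (C : sctx Sy) : forall r,
  es_count_ctx (crename r C) = es_count_ctx C.
Proof. induction C; intros r; simpl; rewrite ?es_count_erename; auto. Qed.

Lemma es_count_pure {Sy} (t : eterm Sy) : pure t -> es_count t = 0.
Proof. induction t; simpl; intuition lia. Qed.

Lemma depth_le_es_count {Sy} (C : sctx Sy) : depth C <= es_count_ctx C.
Proof. induction C; simpl; lia. Qed.

Lemma es_count_leaf {Sy} (r : eterm Sy) : leaf r -> es_count r = 0.
Proof. destruct r; simpl; tauto. Qed.

Lemma ufstep_m_es_count {Sy} (x y : eterm Sy) :
  ufstep multiplicative x y -> proper Var x -> es_count y = S (es_count x).
Proof.
  intros H Hp. inversion H as [C L t u HL HC Ek Ex Ey |]; subst.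
  rewrite proper_plug in Hp. simpl in Hp. rewrite proper_plug in Hp. simpl in Hp.
  rewrite !es_count_plug. simpl. rewrite es_count_plug, es_count_erename. simpl.
  rewrite es_count_pure by tauto. lia.
Qed.

(** The copied [u] is no explicit substitution and unfolds to a value, so it is a leaf and no
    explicit substitution is duplicated. *)
Lemma ufstep_e_es_count {Sy} (x y : eterm Sy) :
  ufstep exponential x y -> es_count y = es_count x.
Proof.
  intros H. inversion H as [| C D L u HL HC Hu Hv Ek Ex Ey]; subst.
  rewrite unfold_in_unf in Hv.
  rewrite !es_count_plug. simpl.
  rewrite !es_count_plug, es_count_erename, es_count_crename, es_count_leaf
    by (eapply value_leaf; eauto).
  simpl. lia.
Qed.

(* [n] is the number of explicit substitutions between the variable that the
   exponential step replaces and the one that binds it. *)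
Definition e_redex {Sy} (x : eterm Sy) (n : nat) : Prop :=
  exists C, redex_at C (EVar n) /\ x = plug C (EVar n).

(** The copy of [u] is itself at a redex position of [y], and by uniqueness the only one. If it is a
    variable, its index was raised by [S (depth D)]. *)
Lemma ufstep_e_redex {Sy} (x y : eterm Sy) :
  ufstep exponential x y -> proper Var x ->
  exists n, e_redex x n /\ n < es_count x /\ forall m, e_redex y m -> n < m.
Proof.
  intros H Hp. inversion H as [| C D L u HL HC Hu Hv Ek Ex Ey]; subst.
  exists (depth D). split; [| split].
  - exists (comp C (CES D (plug L u))). rewrite plug_comp. split; trivial.
    now apply redex_at_e.
  - rewrite es_count_plug. simpl. rewrite es_count_plug.
    pose proof (depth_le_es_count D). lia.
  - intros m (C2 & R2 & E).
    rewrite unfold_in_unf, env_comp in Hv.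
    pose proof (value_leaf _ Hu Hv) as Hl.
    set (D' := crename (up_ren (Nat.add (depth L))) D) in *.
    set (u' := erename (Nat.add (S (depth D))) u) in *.
    assert (R : redex_at (comp C (comp L (CES D' u))) u').
    { split; [| split].
      - rewrite proper_plug in Hp. simpl in Hp. rewrite proper_plug in Hp.
        destruct Hp as (_ & (HpL & _) & _).
        apply useful_iff_env in HC as [HC Ha]. apply useful_iff_env.
        rewrite !evaluable_env_comp, !applied_comp in *. simpl in *.
        unfold D'. rewrite evaluable_env_crename, applied_crename, scons_up_ren_env.
        rewrite <- (unf_plug_substitution _ _ HL), (applied_substitution _ HL).
        intuition. now apply proper_ctx_substitution.
      - unfold u'. now destruct u.
      - rewrite !env_comp. simpl. unfold D', u'. now rewrite unf_copy. }
    destruct (redex_at_unique R R2) as [_ E'].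
    { now rewrite !plug_comp. }
    unfold u' in E'. destruct u; simpl in E'; try discriminate.
    injection E' as <-. lia.
Qed.

Lemma derivation_proper {Sy} (x y : eterm Sy) (d : derivation ufstep x y) :
  proper Var x -> proper Var y /\ es_count y = es_count x + mlen d.
Proof.
  induction d as [x | k x y z H d IH]; intros Hx; simpl.
  - split; [trivial | lia].
  - destruct (IH (ufstep_proper H Hx)) as [Hz E]. split; trivial. destruct k.
    + rewrite (ufstep_m_es_count H Hx) in E. lia.
    + rewrite (ufstep_e_es_count H) in E. lia.
Qed.

(** Each of the [mlen d] multiplicative steps is followed by a run of exponential steps no longer
    than the final number [es_count x + mlen d] of explicit substitutions. The second case adds an
    initial run, of length at most [es_count x - n] because the indices increase strictly below
    [es_count x]. *)
Lemma len_bound {Sy} (x y : eterm Sy) (d : derivation ufstep x y) :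
  proper Var x ->
  len d <= mlen d + mlen d * (es_count x + mlen d) \/
  exists n, e_redex x n /\
    len d + n <= mlen d + mlen d * (es_count x + mlen d) + es_count x.
Proof.
  induction d as [x | k x y z H d IH]; intros Hx; simpl.
  - left. lia.
  - specialize (IH (ufstep_proper H Hx)). destruct k.
    + left. rewrite (ufstep_m_es_count H Hx) in IH.
      destruct IH as [IH | (n & _ & IH)]; nia.
    + right. rewrite (ufstep_e_es_count H) in IH.
      destruct (ufstep_e_redex H Hx) as (n & Hn & Hlt & Hnext).
      exists n. split; trivial.
      destruct IH as [IH | (m & Hm%Hnext & IH)]; lia.
Qed.

Lemma exponential_derivation {Sy} (x y : eterm Sy)
    (e : derivation (unlabelled (ufstep exponential)) x y) :
  exists d : derivation ufstep x y, len d = len e /\ mlen d = 0.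
Proof.
  induction e as [x | k x y z H e (d & Hl & Hm)].
  - now exists (dnil _).
  - exists (dcons exponential (H : ufstep exponential x y) d). simpl. auto.
Qed.

Theorem theorem8 (Sy : Type) :
  locally_bounded_system (@fstep Sy) (@ufstep Sy) /\
  quadratic_overhead (@fstep Sy) (@ufstep Sy).
Proof.
  assert (start : forall t : term Sy, proper Var (embed t) /\ es_count (embed t) = 0).
  { intros t. split; [apply pure_proper | apply es_count_pure]; apply pure_embed. }
  split; [split; [split |] |].
  - apply fstep_deterministic.
  - apply ufstep_deterministic.
  - intros t u d. apply normal_unfold, (derivation_proper d), start.
  - intros t u d. apply projection.
  (* A purely exponential derivation is a single initial run, bounded by the number of explicit
     substitutions of [u], which is [mlen d]. *)
  - exists 1. intros t u v d e. destruct (start t) as [Ht E0].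
    destruct (derivation_proper d Ht) as [Hu E].
    destruct (exponential_derivation e) as (d' & <- & Hm).
    destruct (len_bound d' Hu) as [H | (n & _ & H)]; rewrite Hm in H; simpl in H; lia.
  (* Starting without explicit substitutions, [m = mlen d] bounds the length by [m + m * m], which
     is at most [2 * m ^ 2]. *)
  - exists 2. intros t u d. destruct (start t) as [Ht E0].
    destruct (projection d) as [d' Hd]. revert d' Hd. rewrite unfold_embed.
    intros d' Hd. exists d'. split; trivial. rewrite Hd. simpl.
    destruct (len_bound d Ht) as [H | (n & _ & H)]; rewrite E0 in H; nia.
Qed.
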